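(* Let $(X,d)$ be a metric space with $|X|\ge 3$ and let $T:X\to X$ be a mapping contracting hypotenuse of a right-angled triangle. If $T$ has two (distinct) fixed points in $X$, then the fixed point equation $x=Tx$ is Ulam--Hyers stable.
   Context: Let $(X,d)$ be a metric space with $|X|\ge 3$. A mapping $T:X\to X$ is called a mapping contracting hypotenuse of a right-angled triangle if there exists $\beta$ with $0\le\beta<1$ such that $$[d(Tx,Ty)]^2+[d(Ty,Tz)]^2\le \beta\left([d(x,y)]^2+[d(y,z)]^2\right)$$ for any three pairwise distinct points $x,y,z\in X$. For a metric space $(X,d)$ and a mapping $T:X\to X$, the fixed point equation $x=Tx$ is Ulam--Hyers stable if there is a constant $K>0$ such that for each $\varepsilon>0$ and each $v\in X$ with $d(v,Tv)\le\varepsilon$, there exists $u\in X$ with $u=Tu$ such that $d(u,v)\le K\varepsilon$. *)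

(* Defs.v *)
From mathcomp Require Import all_boot all_order all_algebra.
From mathcomp Require Import all_classical all_reals topology.

Set Implicit Arguments.
Unset Strict Implicit.
Unset Printing Implicit Defensive.

Import Order.TTheory GRing.Theory Num.Theory.

Local Open Scope ring_scope.

Definition contracting_hypotenuse (R : realType) (X : metricType R)
    (T : X -> X) : Prop :=
  exists beta : R, 0 <= beta < 1 /\
    forall x y z : X, x != y -> y != z -> x != z ->
      mdist (T x) (T y) ^+ 2 + mdist (T y) (T z) ^+ 2
        <= beta * (mdist x y ^+ 2 + mdist y z ^+ 2).

Definition Ulam_Hyers_stable (R : realType) (X : metricType R)
    (T : X -> X) : Prop :=
  exists K : R, 0 < K /\
    forall (eps : R) (v : X), 0 < eps -> mdist v (T v) <= eps ->
      exists u : X, u = T u /\ mdist u v <= K * eps.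

(* Main.v *)
Require Import Defs.
From mathcomp Require Import all_boot all_order all_algebra.
From mathcomp Require Import all_classical all_reals topology.
From mathcomp Require Import lra.

(** Let [p] and [q] be two fixed points of [T], let [v] be a third point, and
    set [a = d(v,p)], [b = d(v,q)], [a' = d(Tv,p)], [b' = d(Tv,q)].  The
    contraction hypothesis on the triple [p, v, q] says that
    [a'^2 + b'^2 <= beta * (a^2 + b^2)], so that passing from [v] to [T v]
    destroys at least the amount [(1 - beta) * (a^2 + b^2)].  If [d(v,Tv)] is at
    most [eps], however, the triangle inequality gives [a' >= a - eps] and
    [b' >= b - eps], hence a loss of at most [2 * eps * (a + b)]
    ([sqr_loss_le]).  Since [(a + b)^2 <= 2 * (a^2 + b^2)], comparing the two
    bounds the distance from [v] to each of [p] and [q] by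
    [4 / (1 - beta) * eps]. *)

Set Implicit Arguments.
Unset Strict Implicit.
Unset Printing Implicit Defensive.

Import Order.TTheory GRing.Theory Num.Theory.

Local Open Scope classical_set_scope.
Local Open Scope card_scope.
Local Open Scope ring_scope.

(** The square lies above its tangent at [a], so that
    [a'^2 >= 2 * a * a' - a^2]; then bound [a'] below by [a - e]. *)
Lemma sqr_loss_le (R : realFieldType) (a a' e : R) :
  0 <= a -> a <= a' + e -> a ^+ 2 - a' ^+ 2 <= 2 * e * a.
Proof.
move=> a0 le_a.
have tangent : 0 <= (a - a') ^+ 2 by exact: sqr_ge0.
have slope : 0 <= a * (a' + e - a) by rewrite mulr_ge0 // subr_ge0.
nra.
Qed.

(** A vector of the quadrant that a displacement of at most [e] per coordinate
    contracts has size of order [e]: the loss of squared norm is at least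
    [(1 - beta) * (a + b)^2 / 2] and at most [2 * e * (a + b)], and dividing by
    [a + b] gives the constant. *)
Lemma displaced_contraction_le (R : realFieldType) (beta e a b a' b' : R) :
  beta < 1 -> 0 <= e -> 0 <= a -> 0 <= b -> a <= a' + e -> b <= b' + e ->
  a' ^+ 2 + b' ^+ 2 <= beta * (a ^+ 2 + b ^+ 2) ->
  a + b <= 4 / (1 - beta) * e.
Proof.
move=> beta1 e0 a0 b0 le_a le_b contr.
have gap : 0 < 1 - beta by rewrite subr_gt0.
have lossa := sqr_loss_le a0 le_a.
have lossb := sqr_loss_le b0 le_b.
have loss : (1 - beta) * (a ^+ 2 + b ^+ 2) <= 2 * e * (a + b) by lra.
rewrite mulrAC ler_pdivlMr //.
have [->|ab_neq0] := eqVneq (a + b) 0; first by rewrite mul0r mulr_ge0.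
have ab_gt0 : 0 < a + b by rewrite lt_def ab_neq0 addr_ge0.
rewrite -(ler_pM2r ab_gt0).
have spread : 0 <= (1 - beta) * (a - b) ^+ 2.
  by rewrite mulr_ge0 ?sqr_ge0 // ltW.
nra.
Qed.

Theorem theorem2p10 (R : realType) (X : metricType R) (T : X -> X)
    (cardX : `I_3 #<= [set: X])
    (hT : contracting_hypotenuse T)
    (fixT : exists p q : X, [/\ p != q, p = T p & q = T q]) :
  Ulam_Hyers_stable T.
Proof.
have [beta [/andP[beta0 beta1] contr]] := hT.
have [p [q [pq Tp Tq]]] := fixT.
have K_gt0 : 0 < 4 / (1 - beta) by rewrite divr_gt0 // subr_gt0.
exists (4 / (1 - beta)); split=> // eps v eps0 le_eps.
(* The triple [p, v, q] has distinct points only when [v] is neither [p] nor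
   [q]; otherwise [v] is itself a fixed point at distance 0. *)
have [vp|pv] := eqVneq p v.
  by exists p; split=> //; rewrite vp mdistxx mulr_ge0 // ltW.
have [vq|vq] := eqVneq v q.
  by exists q; split=> //; rewrite vq mdistxx mulr_ge0 // ltW.
exists p; split=> //.
have := contr p v q pv vq pq; rewrite -Tp -Tq => contr_pvq.
have le_p : mdist p v <= mdist p (T v) + eps.
  apply: (le_trans (metric_triangle _ (T v) _)).
  by rewrite lerD2l metric_sym.
have le_q : mdist v q <= mdist (T v) q + eps.
  apply: (le_trans (metric_triangle _ (T v) _)).
  by rewrite addrC lerD2l.
apply: le_trans (displaced_contraction_le beta1 (ltW eps0) (mdist_ge0 _ _)
  (mdist_ge0 _ _) le_p le_q contr_pvq).
by rewrite lerDl mdist_ge0.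
Qed.
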